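(* Let $n\ge 2$, $k\ge1$ and $I_*=(i_1,\dots,i_k)\in\{1,\dots,n-1\}^k$. Define the formal power series $$\mathcal{V}_{n,I_*}(t_1,\dots,t_k)=\sum_{(a_1,\dots,a_k)\in\mathbb{N}^k}V_n(x_{i_1}^{a_1}\cdots x_{i_k}^{a_k})\,t_1^{a_1}\cdots t_k^{a_k}.$$ Then it is the rational function $$\mathcal{V}_{n,I_*}(t_1,\dots,t_k)=\frac{1}{q(t_1)\cdots q(t_k)}\sum_{(j_1,\dots,j_k)\in\{0,1\}^k}Q_{j_1}(t_1)\cdots Q_{j_k}(t_k)\,V_n(x_{i_1}^{j_1}\cdots x_{i_k}^{j_k}),$$ where $q(t)=(1-s^3t)(1+st)$, $Q_0(t)=1-(s^3-s)t$ and $Q_1(t)=t$.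
   Context: $\mathcal{B}_n$ is the Artin braid group with standard generators $x_1,\dots,x_{n-1}$; $\widehat{\beta}$ is the closure of $\beta\in\mathcal{B}_n$. The Jones polynomial $V_L$ is normalized by $V(\text{unknot})=1$ and $q^{-1}V_{L_+}-qV_{L_-}=(q^{1/2}-q^{-1/2})V_{L_0}$; with $s=q^{-1/2}$ it is a Laurent polynomial in $s$, and $V_n(\beta)=V(\widehat\beta)$. Conventions: in a braid word, closures of $\alpha x_i^{e+2}\gamma$, $\alpha x_i^{e+1}\gamma$, $\alpha x_i^{e}\gamma$ play the roles of $L_-,L_0,L_+$ (e.g. $V_2(x_1^2)=-s-s^5$). $\mathbb{N}=\{0,1,2,\dots\}$. *)

(* Defs.v *)
From mathcomp Require Import all_boot all_order all_algebra.
Set Implicit Arguments.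
Unset Strict Implicit.
Unset Printing Implicit Defensive.
Import Order.TTheory GRing.Theory Num.Theory.
Local Open Scope ring_scope.

(* Braid words.  A letter (true, i) is the generator x_i, (false, i)   *)
(* is x_i^{-1}; strands/generators are numbered as in the paper,       *)
(* x_i (1 <= i <= n-1) crosses the strands at positions i and i+1.     *)
Definition letter := (bool * nat)%type.
Definition bword := seq letter.

Section Jones.
Variables (R : comUnitRingType) (s : R).

Definition npos (w : bword) : nat := count (fun l : letter => l.1) w.
Definition nneg (w : bword) : nat := count (fun l : letter => ~~ l.1) w.

(* A Kauffman state of w is a (size w)-tuple of booleans; st`_l = true
   means the crossing l receives the A^{-1}-smoothing.
   For a positive letter x_i the A^{-1}-smoothing is the horizontal
   (cup/cap, e_i) one, for x_i^{-1} it is the vertical (identity) one. *)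
Section Loops.
Variables (n : nat) (w : bword) (st : (size w).-tuple bool).

Definition gen (l : nat) : nat := (nth (true, 0%N) w l).2.
Definition horiz (l : nat) : bool :=
  (l < size w)%N && (nth false st l == (nth (true, 0%N) w l).1).

(* Vertices of the state diagram of the braid closure: (level, position),
   levels 0..size w, positions 0..n-1 (0-based); crossing number l sits
   between level l and level l+1; level (size w) is glued to level 0. *)
Definition svert := ('I_(size w).+1 * 'I_n)%type.

Definition sedge0 (x y : svert) : bool :=
  let: (lx, px) := x in let: (ly, py) := y in
  [|| [&& (lx == size w :> nat), (ly == 0%N :> nat) & (px == py)],
      [&& (lx.+1 == ly :> nat), (px == py) &
          ~~ (horiz lx && ((px.+1 == gen lx) || (px == gen lx :> nat)))],
      [&& (lx == ly), (px.+1 == gen lx), (py == gen lx :> nat) & horiz lx]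
    | [&& (lx == ly), (0 < lx)%N, (px.+1 == gen lx.-1),
          (py == gen lx.-1 :> nat) & horiz lx.-1]].

Definition sedge : rel svert := fun x y => sedge0 x y || sedge0 y x.

(* Number of circles of the state = connected components of the
   (2-regular) state graph. *)
Definition nloops : nat := n_comp sedge predT.
End Loops.

Definition nAinv (w : bword) (st : (size w).-tuple bool) : nat :=
  count id st.

(* Loop value d = -A^2 - A^{-2} with s = A^{-2}. *)
Definition dloop : R := - s^-1 - s.

(* Jones polynomial of the closure of the n-strand braid w, via the
   Kauffman bracket:  V = (-A^3)^{-w} <closure>, <O> = 1, with
   A = s^{-1/2}.  Written in s:  the factor of a state is
   (-1)^{writhe} * s^{npos - 2 nneg + #A^{-1}-smoothings} * d^{loops-1}. *)
Definition jones (n : nat) (w : bword) : R :=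
  (-1) ^+ size w *
  \sum_(st : (size w).-tuple bool)
     s ^ ((npos w)%:Z - (2 * nneg w)%:Z + (nAinv st)%:Z)
       * dloop ^+ (nloops n st).-1.

(* Monomials t_1^{a_1}...t_k^{a_k} and formal power series in k
   variables (as coefficient functions). *)
Definition mono (k : nat) := {ffun 'I_k -> nat}.

Definition pword (k : nat) (I : 'I_k -> nat) (a : 'I_k -> nat) : bword :=
  flatten [seq nseq (a m) (true, I m) | m <- enum 'I_k].

Definition mul_var (k : nat) (m : 'I_k) (p : {poly R}) (f : mono k -> R)
  : mono k -> R :=
  fun a => \sum_(i < (a m).+1)
             p`_i * f [ffun j => if j == m then (a m - i)%N else a j].

Definition mul_all (k : nat) (p : {poly R}) (f : mono k -> R) : mono k -> R :=
  foldr (fun m g => mul_var m p g) f (enum 'I_k).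

Definition qser : {poly R} := (1 - (s ^+ 3) *: 'X) * (1 + s *: 'X).
Definition Qser (j : bool) : {poly R} :=
  if j then 'X else 1 - (s ^+ 3 - s) *: 'X.

End Jones.

(* Main.v *)
Require Import Defs.
From mathcomp Require Import all_boot all_order all_algebra.
From mathcomp Require Import zify ring.
Set Implicit Arguments.
Unset Strict Implicit.
Unset Printing Implicit Defensive.
Import GRing.Theory.

(* All braids involved are positive, so expanding a letter [x_i] of the Kauffman
   state sum gives the operator [- s - s^2 e_i], where [e_i] is the cup-cap.
   Deleting a vertical smoothing does not change the number of loops, and
   [e_i e_i] has exactly one loop more than [e_i], i.e. [e_i^2 = d e_i] with
   [d = - s^-1 - s]. Hence a letter satisfies [x^2 = (s^3 - s) x + s^4], so in
   each exponent the Jones polynomials obey the linear recurrence with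
   characteristic series [q(t) = 1 - (s^3 - s) t - s^4 t^2]. Multiplying by
   [q(t_m)] therefore kills every coefficient with [a_m >= 2] and leaves the
   two terms [Q_0, Q_1]; doing this for one variable at a time, the recurrence
   in the other variables is preserved. *)

(** * Connected components and state graphs of smoothed diagrams *)

(** Both maps send edges to paths and are inverse to each other up to paths, so they induce a
    bijection between the components inside [a] and those of [e']. Closedness of [a] keeps paths in
    the region where [r] respects edges. *)
Lemma n_comp_retract (T T' : finType) (e : rel T) (e' : rel T')
    (h : T' -> T) (r : T -> T') (a : {pred T}) :
  connect_sym e -> connect_sym e' -> closed e a ->
  cancel h r -> (forall x', h x' \in a) ->
  (forall x, x \in a -> connect e x (h (r x))) ->
  (forall x y, x \in a -> e x y -> connect e' (r x) (r y)) ->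
  (forall x' y', e' x' y' -> connect e (h x') (h y')) ->
  n_comp e a = n_comp e' predT.
Proof.
move=> se se' ca hK ha ux er eh.
have := adjunction_n_comp h se se' ca _ => ->; last first.
  split=> [x xa|x' y' _]; first by exists (r x); apply: ux.
  apply/idP/idP=> [/connectP[p]|/connectP[p ep lp]].
    elim: p x' => [x' _ -> //|z p IH x' /= /andP[xz zp] lp].
    exact: connect_trans (eh _ _ xz) (IH _ zp lp).
  rewrite -(hK x') -(hK y') lp.
  elim: p (h x') (ha x') ep {lp} => [//|z p IH x xa /= /andP[xz zp]].
  apply: connect_trans (er _ _ xa xz) (IH _ _ zp).
  by rewrite -(ca _ _ xz).
by apply: eq_n_comp_r => x; rewrite !inE ha.
Qed.

(* [hz l] tells whether crossing [l] is smoothed into a cup and a cap at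
   positions [(g l).-1], [g l]. *)
Definition half_edge (n N : nat) (hz : nat -> bool) (g : nat -> nat)
    (x y : 'I_N.+1 * 'I_n) : bool :=
  let: (lx, px) := x in let: (ly, py) := y in
  [|| [&& (lx == N :> nat), (ly == 0%N :> nat) & (px == py)],
      [&& (lx.+1 == ly :> nat), (px == py) &
          ~~ (hz lx && ((px.+1 == g lx) || (px == g lx :> nat)))],
      [&& (lx == ly), (px.+1 == g lx), (py == g lx :> nat) & hz lx]
    | [&& (lx == ly), (0 < lx)%N, (px.+1 == g lx.-1),
          (py == g lx.-1 :> nat) & hz lx.-1]].

Definition edge n N hz g : rel ('I_N.+1 * 'I_n) :=
  fun x y => half_edge hz g x y || half_edge hz g y x.

Lemma edge_connect_sym n N hz g : connect_sym (@edge n N hz g).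
Proof. by apply: sym_connect_sym => x y; rewrite /edge orbC. Qed.

(** The four kinds of edges without ordinals, so that they can be inverted by cases and their levels
    shifted by arithmetic: closure of the braid, vertical strand, and the arcs of a horizontal
    crossing [j] at levels [j] and [j.+1]. *)
Variant nat_edge (N : nat) (hz : nat -> bool) (g : nat -> nat) :
    nat -> nat -> nat -> nat -> Prop :=
  | Glue p : nat_edge N hz g N p 0 p
  | Vert j p of j < N & ~~ (hz j && ((p.+1 == g j) || (p == g j))) :
      nat_edge N hz g j p j.+1 p
  | Cup j p of hz j & p.+1 = g j : nat_edge N hz g j p j p.+1
  | Cap j p of hz j & p.+1 = g j : nat_edge N hz g j.+1 p j.+1 p.+1.

Lemma half_edge_nat n N hz g (x y : 'I_N.+1 * 'I_n) :
  half_edge hz g x y -> nat_edge N hz g x.1 x.2 y.1 y.2.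
Proof.
case: x y => [[i iN] p] [[j jN] q] /=; rewrite -!val_eqE /=.
case/or4P.
- by case/and3P=> /eqP-> /eqP-> /eqP->; constructor.
- by case/and3P=> /eqP ij /eqP-> H; subst j; constructor.
- by case/and4P=> /eqP-> /eqP pg /eqP-> hj; rewrite -pg; constructor.
case/and5P=> /eqP<- + /eqP pg /eqP->; case: i iN pg => //= i _ pg _ hj.
by rewrite -pg; constructor.
Qed.

Lemma nat_half_edge n N hz g (x y : 'I_N.+1 * 'I_n) :
  nat_edge N hz g x.1 x.2 y.1 y.2 -> half_edge hz g x y.
Proof.
case: x y => [[i iN] [p pn]] [[j jN] [q qn]] /=.
rewrite -!val_eqE /= => E; apply/or4P; case: E iN jN pn qn => {i j p q}.
- by move=> p *; constructor 1; rewrite !eqxx.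
- by move=> j p _ H *; constructor 2; rewrite !eqxx.
- by move=> j p hj <- *; constructor 3; rewrite !eqxx.
by move=> j p hj <- *; constructor 4; rewrite /= !eqxx.
Qed.

Section NatConnect.
Variables (n N : nat) (hz : nat -> bool) (g : nat -> nat).

(** Vacuous for coordinates out of range; hence only the middle vertex in transitivity needs
    bounds. *)
Definition nat_connect (i p j q : nat) : Prop :=
  forall x y : 'I_N.+1 * 'I_n, x.1 = i :> nat -> x.2 = p :> nat ->
    y.1 = j :> nat -> y.2 = q :> nat -> connect (edge hz g) x y.

Lemma nat_connect0 i p : nat_connect i p i p.
Proof.
move=> [x1 x2] [y1 y2] /= <- <- e1 e2; suff -> : (x1, x2) = (y1, y2) by [].
by congr (_, _); apply: val_inj.
Qed.

Lemma nat_connect1 i p j q : nat_edge N hz g i p j q -> nat_connect i p j q.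
Proof.
move=> E x y xi xp yj yq; apply: connect1; apply/orP; left.
by apply: nat_half_edge; rewrite xi xp yj yq.
Qed.

Lemma nat_connect_sym i p j q : nat_connect i p j q -> nat_connect j q i p.
Proof. by move=> C x y *; rewrite edge_connect_sym; apply: C. Qed.

Lemma nat_connect_trans j q i p k r : j <= N -> q < n ->
  nat_connect i p j q -> nat_connect j q k r -> nat_connect i p k r.
Proof.
rewrite -ltnS => jN qn C1 C2 x y *.
apply: (connect_trans (y := (Ordinal jN, Ordinal qn))); first exact: C1.
exact: C2.
Qed.

End NatConnect.

(** * Inserting a crossing into a diagram *)

(** The new level is [l.+1]: [insert_level] skips it, while [remove_level] folds it onto level [l].
    This explains the different indices of [bump] and [unbump]. *)
Definition insert_level n N l (x : 'I_N.+1 * 'I_n) : 'I_N.+2 * 'I_n :=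
  (inord (bump l.+1 x.1), x.2).
Definition remove_level n N l (x : 'I_N.+2 * 'I_n) : 'I_N.+1 * 'I_n :=
  (inord (unbump l x.1), x.2).

Lemma insert_levelE n N l (x : 'I_N.+1 * 'I_n) :
  (insert_level l x).1 = bump l.+1 x.1 :> nat.
Proof.
case: x => x p /=; rewrite inordK //; have := ltn_ord x; rewrite /bump.
by case: (l < x); lia.
Qed.

Lemma remove_levelE n N l (x : 'I_N.+2 * 'I_n) : l <= N ->
  (remove_level l x).1 = unbump l x.1 :> nat.
Proof.
case: x => x p /= lN; rewrite inordK //; have := ltn_ord x; rewrite /unbump.
by case: (ltnP l x); lia.
Qed.

Lemma insert_levelK n N l : l <= N ->
  cancel (@insert_level n N l) (@remove_level n N l).
Proof.
move=> lN x; rewrite [RHS]surjective_pairing; congr (_, _); apply: val_inj.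
change (_ = _) with ((remove_level l (insert_level l x)).1 = x.1 :> nat).
rewrite remove_levelE // insert_levelE /bump /unbump.
by case: (ltnP l x.1) => ?; lia.
Qed.

(* Diagram [(hz, g)] arises from [(hz', g')] by inserting a crossing at place
   [l], smoothed vertically, or horizontally just above an equal one; in the
   second case a small circle splits off. *)
Section Insertion.
Variables (n N l : nat) (hz hz' : nat -> bool) (g g' : nat -> nat).
Hypothesis lN : l <= N.
Hypothesis hzN : forall j, hz j -> j <= N.
Hypothesis hz_lt : forall j, j < l -> hz' j = hz j.
Hypothesis g_lt : forall j, j < l -> g' j = g j.
Hypothesis hz_ge : forall j, l <= j -> hz' j = hz j.+1.
Hypothesis g_ge : forall j, l <= j -> g' j = g j.+1.
Hypothesis hz_l : hz l -> hz l.+1.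
Hypothesis g_l : hz l -> g l.+1 = g l.

Let E := @edge n N.+1 hz g.
Let E' := @edge n N hz' g'.

(** The two vertices enclosed between the equal horizontal crossings [l] and [l.+1]; empty if [l] is
    vertical. *)
Definition small_circle : pred ('I_N.+2 * 'I_n) :=
  fun x => [&& hz l, x.1 == l.+1 :> nat & (x.2.+1 == g l) || (x.2 == g l :> nat)].

(** Both adjacent crossings are horizontal at these positions, so no strand leaves vertically, and
    the two arcs only join the two vertices. By [hzN] the closing edge starts at a higher level. *)
Lemma small_circle_closed : closed E [predC small_circle].
Proof.
apply: predC_closed; suff half x y : half_edge hz g x y ->
    small_circle x = small_circle y.
  by move=> x y /orP[/half|/half/esym].
move/half_edge_nat; rewrite /small_circle; case: x y => [i p] [j q] /=.
case hl: (hz l) => //=.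
have hl1 := hzN (hz_l hl); have gl := g_l hl.
case.
- by move=> r; lia.
- move=> k r kN; case: (ltngtP k l) => [?|?|->]; last 1 first.
    by rewrite hl /=; lia.
  + by lia.
  have [->|] := eqVneq k l.+1; last by lia.
  by rewrite (hz_l hl) gl /=; lia.
- move=> k r hk gk; have [kl|] := eqVneq k l.+1; last by lia.
  by move: gk; rewrite kl gl; lia.
move=> k r hk gk; have [kl|] := eqVneq k l; last by lia.
by move: gk; rewrite kl; lia.
Qed.

Lemma vert_connect p : ~~ (hz l && ((p.+1 == g l) || (p == g l))) ->
  nat_connect n N.+1 hz g l.+1 p l p.
Proof. by move=> H; apply/nat_connect_sym/nat_connect1/Vert. Qed.

Lemma connect_remove x : x \notin small_circle ->
  connect E x (insert_level l (remove_level l x)).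
Proof.
move=> xc; suff: nat_connect n N.+1 hz g x.1 x.2 (bump l.+1 (unbump l x.1)) x.2.
  by apply=> //; rewrite insert_levelE remove_levelE.
have [xl|xl] := eqVneq (nat_of_ord x.1) l.+1; last first.
  suff -> : bump l.+1 (unbump l x.1) = x.1 by apply: nat_connect0.
  by move: xl; rewrite /bump /unbump; case: (ltnP l x.1) => ? ?; lia.
have -> : bump l.+1 (unbump l x.1) = l by rewrite xl /bump /unbump; lia.
rewrite xl; apply: vert_connect; apply: contra xc.
by rewrite unfold_in /small_circle xl eqxx.
Qed.

Lemma remove_edge x y : x \notin small_circle -> E x y ->
  connect E' (remove_level l x) (remove_level l y).
Proof.
suff half u v : u \notin small_circle -> v \notin small_circle ->
    half_edge hz g u v -> connect E' (remove_level l u) (remove_level l v).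
  move=> xc xy; have yc: y \notin small_circle.
    by have := small_circle_closed xy; rewrite !inE => <-.
  case/orP: xy => [/half|/half]; first exact.
  by rewrite (@edge_connect_sym n N hz' g'); apply.
move=> uc vc /half_edge_nat uv.
suff: nat_connect n N hz' g' (unbump l u.1) u.2 (unbump l v.1) v.2.
  by apply; rewrite ?remove_levelE.
move: uc vc; rewrite !unfold_in.
have := ltn_ord v.1; have := ltn_ord u.1.
case: uv.
- move=> p *; have -> : unbump l N.+1 = N by rewrite /unbump; lia.
  by apply: nat_connect1; constructor.
- move=> j p jN H _ _ _ _; case: (ltngtP j l) => jl.
  + have -> : unbump l j = j by rewrite /unbump; lia.
    have -> : unbump l j.+1 = j.+1 by rewrite /unbump; lia.
    by apply: nat_connect1; constructor; rewrite ?hz_lt ?g_lt //; lia.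
  + have -> : unbump l j = j.-1 by rewrite /unbump; lia.
    have -> : unbump l j.+1 = j.-1.+1 by rewrite /unbump; lia.
    apply: nat_connect1; constructor; first by lia.
    by rewrite hz_ge ?g_ge ?prednK //; lia.
  have -> : unbump l j.+1 = unbump l j by rewrite /unbump; lia.
  exact: nat_connect0.
- move=> j p hj gj _ _ _ _; apply: nat_connect1; case: (ltngtP j l) => jl.
  + have -> : unbump l j = j by rewrite /unbump; lia.
    by constructor; rewrite ?hz_lt ?g_lt.
  + have -> : unbump l j = j.-1 by rewrite /unbump; lia.
    by constructor; rewrite ?hz_ge ?g_ge ?prednK //; lia.
  (* The arc of the removed crossing at level [l] is replaced by that of its equal neighbour, which
     takes index [l]. *)
  subst j; have -> : unbump l l = l by rewrite /unbump; lia.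
  by constructor; rewrite ?hz_ge ?g_ge ?hz_l ?g_l.
move=> j p hj gj _ _ uc _; apply: nat_connect1; case: (ltngtP j l) => jl.
- have -> : unbump l j.+1 = j.+1 by rewrite /unbump; lia.
  by constructor; rewrite ?hz_lt ?g_lt.
- have -> : unbump l j.+1 = j.-1.+1 by rewrite /unbump; lia.
  by constructor; rewrite ?hz_ge ?g_ge ?prednK //; lia.
(* The other arc of crossing [l] lies on the small circle, which is excluded. *)
by move: uc; rewrite -jl hj gj !eqxx.
Qed.

Lemma insert_edge x y : E' x y ->
  connect E (insert_level l x) (insert_level l y).
Proof.
suff half u v : half_edge hz' g' u v ->
    connect E (insert_level l u) (insert_level l v).
  case/orP=> [/half //|/half]; by rewrite (@edge_connect_sym n N.+1 hz g).
move=> /half_edge_nat uv.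
suff: nat_connect n N.+1 hz g (bump l.+1 u.1) u.2 (bump l.+1 v.1) v.2.
  by apply; rewrite ?insert_levelE.
have := ltn_ord v.2; have := ltn_ord u.2.
case: uv.
- move=> p pn _; have -> : bump l.+1 0 = 0 by [].
  have glue : nat_connect n N.+1 hz g N.+1 p 0 p.
    by apply: nat_connect1; constructor.
  have [lN'|lN'] := ltnP l N.
    by have -> : bump l.+1 N = N.+1 by rewrite /bump; lia.
  (* Here [l = N]: the crossing is added at the very end, and [hzN] makes it vertical, so its strand
     leads up to the new last level before closing. *)
  have -> : bump l.+1 N = l by rewrite /bump; lia.
  apply: nat_connect_trans glue => //.
  have Nl : N = l by lia.
  rewrite {2}Nl.
  apply/nat_connect_sym/vert_connect; apply/negP=> /andP[hl _].
  by have := hzN (hz_l hl); lia.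
- move=> j p jN H pn _; case: (ltngtP j l) => jl.
  + have -> : bump l.+1 j = j by rewrite /bump; lia.
    have -> : bump l.+1 j.+1 = j.+1 by rewrite /bump; lia.
    by apply: nat_connect1; constructor; rewrite -?hz_lt -?g_lt //; lia.
  + have -> : bump l.+1 j = j.+1 by rewrite /bump; lia.
    have -> : bump l.+1 j.+1 = j.+2 by rewrite /bump; lia.
    apply: nat_connect1; constructor; first by lia.
    by rewrite -hz_ge -?g_ge //; lia.
  (* This strand now passes through crossings [l] and [l.+1]. The new crossing does not block it,
     since otherwise its equal neighbour would too. *)
  subst j; have -> : bump l.+1 l = l by rewrite /bump; lia.
  have -> : bump l.+1 l.+1 = l.+2 by rewrite /bump; lia.
  rewrite hz_ge // g_ge // in H.
  apply: (@nat_connect_trans _ _ _ _ l.+1 p) => //; last first.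
    by apply: nat_connect1; constructor.
  apply/nat_connect_sym/vert_connect; apply: contra H => /andP[hl].
  by rewrite hz_l // g_l.
- move=> j p hj gj pn p1n; case: (ltngtP j l) => jl.
  + have -> : bump l.+1 j = j by rewrite /bump; lia.
    by apply: nat_connect1; constructor; rewrite -?hz_lt -?g_lt //; lia.
  + have -> : bump l.+1 j = j.+1 by rewrite /bump; lia.
    by apply: nat_connect1; constructor; rewrite -?hz_ge -?g_ge //; lia.
  subst j; have -> : bump l.+1 l = l by rewrite /bump; lia.
  (* A horizontal new crossing supplies the arc itself; a vertical one is traversed to level [l.+1],
     where the arc now lies, and back. *)
  case hl: (hz l).
    by apply: nat_connect1; constructor; rewrite // -g_l // -g_ge.
  have vert q : nat_connect n N.+1 hz g l.+1 q l q.
    by apply: vert_connect; rewrite hl.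
  apply: (@nat_connect_trans _ _ _ _ l.+1 p) => //.
    by apply/nat_connect_sym/vert.
  apply: nat_connect_trans (vert p.+1); rewrite ?ltnS //.
  by apply: nat_connect1; constructor; rewrite -?hz_ge -?g_ge.
move=> j p hj gj pn p1n; apply: nat_connect1.
have [jl|jl] := ltnP j l.
  have -> : bump l.+1 j.+1 = j.+1 by rewrite /bump; lia.
  by constructor; rewrite -?hz_lt -?g_lt //; lia.
have -> : bump l.+1 j.+1 = j.+2 by rewrite /bump; lia.
by constructor; rewrite -?hz_ge -?g_ge //; lia.
Qed.

Lemma n_comp_insert : n_comp E [predC small_circle] = n_comp E' predT.
Proof.
apply: (@n_comp_retract _ _ E E' (@insert_level n N l) (@remove_level n N l)).
- exact: edge_connect_sym.
- exact: edge_connect_sym.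
- exact: small_circle_closed.
- exact: insert_levelK.
- move=> x; change (~~ small_circle (insert_level l x)).
  rewrite /small_circle insert_levelE.
  by rewrite [_ == l.+1](_ : _ = false) ?andbF // /bump; case: ltnP => ?; lia.
- by move=> x; apply: connect_remove.
- by move=> x y; apply: remove_edge.
by move=> x y; apply: insert_edge.
Qed.

Lemma n_comp_small_circle : hz l -> 0 < g l < n -> n_comp E small_circle = 1.
Proof.
move=> hl /andP[g0 gn]; have sE := @edge_connect_sym n N.+1 hz g.
have l1 : l.+1 < N.+2 by rewrite !ltnS.
have gn' : (g l).-1 < n by lia.
pose x0 : 'I_N.+2 * 'I_n := (Ordinal l1, Ordinal gn').
rewrite -(n_comp_connect sE x0); apply: eq_n_comp_r => x.
have x0c : small_circle x0 by rewrite /small_circle hl /= eqxx prednK // eqxx.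
apply/idP/idP=> [|x0x]; last first.
  have := closed_connect small_circle_closed x0x.
  by rewrite !inE [x0 \in _]x0c => /esym/negbFE.
case/and3P=> _ /eqP xl xg.
suff: nat_connect n N.+1 hz g l.+1 (g l).-1 l.+1 x.2 by apply.
case/orP: xg => /eqP xg; first by rewrite -xg; apply: nat_connect0.
rewrite xg -{2}(prednK g0); apply: nat_connect1.
by constructor; rewrite ?hz_l ?g_l ?prednK.
Qed.

End Insertion.

(** * Loop counts of lists of smoothed crossings *)

(** An entry is a smoothing ([true] if horizontal) with its position. The default entry is vertical,
    so no arcs arise beyond the end of the list. *)
Definition loops (n : nat) (m : seq (bool * nat)) : nat :=
  n_comp (@edge n (size m) (fun l => (nth (false, 0%N) m l).1)
            (fun l => (nth (false, 0%N) m l).2)) predT.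

(** Off the small circle the components are those of the shorter diagram; the circle adds one
    exactly when [c] is horizontal. *)
Lemma loops_insert n m1 m2 (c : bool * nat) :
  (c.1 -> 0 < c.2 < n /\ nth (false, 0) m2 0 = c) ->
  loops n (m1 ++ c :: m2) = loops n (m1 ++ m2) + c.1.
Proof.
move=> hc; rewrite /loops !size_cat /= addnS.
set N := size m1 + size m2; set l := size m1.
have lN : l <= N by rewrite leq_addr.
pose hz j := (nth (false, 0) (m1 ++ c :: m2) j).1.
pose g j := (nth (false, 0) (m1 ++ c :: m2) j).2.
have nth_l : nth (false, 0) (m1 ++ c :: m2) l = c.
  by rewrite nth_cat ltnn subnn.
have nth_lt j : j < l ->
    nth (false, 0) (m1 ++ m2) j = nth (false, 0) (m1 ++ c :: m2) j.
  by move=> jl; rewrite !nth_cat jl.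
have nth_ge j : l <= j ->
    nth (false, 0) (m1 ++ m2) j = nth (false, 0) (m1 ++ c :: m2) j.+1.
  by move=> jl; rewrite !nth_cat !ltnNge jl leqW // subSn.
have nth_l1 : c.1 -> nth (false, 0) (m1 ++ c :: m2) l.+1 = c.
  by case/hc=> _ e; rewrite -nth_ge // nth_cat ltnn subnn.
have hzN j : hz j -> j <= N.
  rewrite leqNgt /hz; apply: contraTN => Nj.
  by rewrite nth_default // size_cat /= addnS.
have [hz_l g_l] : hz l = c.1 /\ g l = c.2 by rewrite /hz /g nth_l.
have hz_l1 : hz l -> hz l.+1 by rewrite hz_l => h; rewrite /hz nth_l1.
have g_l1 : hz l -> g l.+1 = g l by rewrite hz_l g_l => h; rewrite /g nth_l1.
have hz_lt j : j < l -> (nth (false, 0) (m1 ++ m2) j).1 = hz j.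
  by move=> jl; rewrite nth_lt.
have g_lt j : j < l -> (nth (false, 0) (m1 ++ m2) j).2 = g j.
  by move=> jl; rewrite nth_lt.
have hz_ge j : l <= j -> (nth (false, 0) (m1 ++ m2) j).1 = hz j.+1.
  by move=> jl; rewrite nth_ge.
have g_ge j : l <= j -> (nth (false, 0) (m1 ++ m2) j).2 = g j.+1.
  by move=> jl; rewrite nth_ge.
rewrite -(n_comp_insert n lN hzN hz_lt g_lt hz_ge g_ge hz_l1 g_l1).
rewrite (n_compC (@small_circle n N l hz g)) addnC; congr (_ + _).
case c1 : c.1; last first.
  by apply: eq_card0 => x; rewrite !inE [x \in _]unfold_in hz_l c1 andbF.
apply: (n_comp_small_circle lN hzN hz_l1 g_l1); rewrite ?hz_l ?g_l //.
by case: hc.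
Qed.

Lemma loops_vertical n m1 m2 i :
  loops n (m1 ++ (false, i) :: m2) = loops n (m1 ++ m2).
Proof. by rewrite loops_insert /= ?addn0. Qed.

Lemma loops_horizontal n m1 m2 i : 0 < i < n ->
  loops n (m1 ++ [:: (true, i), (true, i) & m2])
  = (loops n (m1 ++ (true, i) :: m2)).+1.
Proof. by move=> hi; rewrite loops_insert /= ?addn1. Qed.

(** Guards the truncated exponent [(loops n m).-1]: an extra loop then really contributes a factor
    [d]. *)
Lemma loops_gt0 n m : 0 < n -> 0 < loops n m.
Proof.
move=> n0; pose x : 'I_(size m).+1 * 'I_n := (ord0, Ordinal n0).
rewrite /loops; set e := edge _ _.
have sE : connect_sym e := @edge_connect_sym _ _ _ _.
by apply/card_gt0P; exists (fingraph.root e x); rewrite inE /= roots_root.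
Qed.

(** * The bracket of positive braid words and its quadratic relation *)

Definition positive (gs : seq nat) : bword := [seq (true, i) | i <- gs].

Lemma nloops_positive n gs (st : (size (positive gs)).-tuple bool) :
  nloops n st = loops n (zip st gs).
Proof.
have szE : size (zip st gs) = size (positive gs).
  by rewrite size_zip size_tuple size_map minnn.
rewrite /nloops /loops szE; apply: eq_n_comp; apply: eq_connect => x y.
have genE l : l < size (positive gs) ->
    gen (positive gs) l = (nth (false, 0) (zip st gs) l).2.
  move=> ll; rewrite nth_zip_cond szE ll /gen.
  by rewrite (nth_map 0) //; move: ll; rewrite size_map.
have hzE l : horiz st l = (nth (false, 0) (zip st gs) l).1.
  rewrite /horiz nth_zip_cond szE; case: ltnP => //= ll.
  by rewrite (nth_map 0) ?eqb_id //; move: ll; rewrite size_map.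
have half u v : sedge0 st u v = half_edge
    (fun l => (nth (false, 0) (zip st gs) l).1)
    (fun l => (nth (false, 0) (zip st gs) l).2) u v.
  rewrite /sedge0 /half_edge; case: u v => [i p] [j q].
  rewrite !hzE.
  have [iN|iN] := ltnP i (size (positive gs)).
    by rewrite !genE // (leq_ltn_trans (leq_pred _)).
  (* At the last level no crossing starts: horizontality is false there, so the generator index
     matters only for the arc of the preceding crossing. *)
  have -> : i = size (positive gs) :> nat by have := ltn_ord i; lia.
  rewrite nth_default ?szE //= !andbF /=.
  by case: (ltnP 0 (size (positive gs))) => s0 /=; rewrite ?andbF // !genE ?prednK.
by rewrite /sedge /edge !half.
Qed.

Local Open Scope ring_scope.

Lemma sum_tuple_cons (R : nmodType) k (F : seq bool -> R) :
  \sum_(st : k.+1.-tuple bool) F st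
  = \sum_(b : bool) \sum_(st : k.-tuple bool) F (b :: st).
Proof.
rewrite pair_big (reindex (fun p : bool * k.-tuple bool => cons_tuple p.1 p.2)) //=.
exists (fun t : k.+1.-tuple bool => (thead t, behead_tuple t)) => [[b t] _|t _] /=.
  by congr (_, _); apply: val_inj.
by rewrite [RHS]tuple_eta; apply: val_inj.
Qed.

Section Bracket.
Variables (R : comUnitRingType) (s : R) (n : nat).

(** The state sum with [m] already smoothed and [gs] still to expand. Each letter contributes a sign
    and a factor [s], and a horizontal smoothing one more [s]. *)
Fixpoint bracket (m : seq (bool * nat)) (gs : seq nat) : R :=
  if gs is i :: gs' then
    - s * bracket (rcons m (false, i)) gs'
    - s ^+ 2 * bracket (rcons m (true, i)) gs'
  else dloop s ^+ (loops n m).-1.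

Lemma bracketE m gs : bracket m gs =
  (-1) ^+ size gs * \sum_(st : (size gs).-tuple bool)
    s ^+ (size gs + count id st) * dloop s ^+ (loops n (m ++ zip st gs)).-1.
Proof.
elim: gs m => [|i gs IH] m /=.
  rewrite (big_pred1 [tuple]) => [|t]; last by apply/esym/eqP/tuple0.
  by rewrite /= cats0 !mul1r.
rewrite (@sum_tuple_cons R _ (fun st => s ^+ (size (i :: gs) + count id st)
   * dloop s ^+ (loops n (m ++ zip st (i :: gs))).-1)) big_bool /= !IH.
rewrite [(-1) ^+ _.+1]exprS -[in RHS]mulrA mulN1r mulrDr opprD addrC mulNr.
congr (- _ - _).
  rewrite mulrCA; congr (_ * _); rewrite mulr_sumr; apply: eq_bigr => st _.
  by rewrite mulrA -exprD cat_rcons; congr (s ^+ _ * _); lia.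
rewrite mulrCA; congr (_ * _); rewrite mulr_sumr; apply: eq_bigr => st _.
by rewrite mulrA -exprS cat_rcons addSn add0n.
Qed.

Lemma jones_positive gs : jones s n (positive gs) = bracket [::] gs.
Proof.
rewrite bracketE /jones.
have <- : size (positive gs) = size gs by rewrite size_map.
congr (_ * _); apply: eq_bigr => st _; rewrite nloops_positive.
congr (_ * _).
have -> : npos (positive gs) = size (positive gs).
  by rewrite /npos count_map size_map count_predT.
have -> : nneg (positive gs) = 0%N by rewrite /nneg count_map count_pred0.
by rewrite muln0 subr0 -PoszD.
Qed.

Lemma bracket_vertical m1 i m2 gs :
  bracket (m1 ++ (false, i) :: m2) gs = bracket (m1 ++ m2) gs.
Proof.
elim: gs m2 => [|j gs IH] m2 /=; first by rewrite loops_vertical.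
by rewrite !rcons_cat /= !IH.
Qed.

Lemma bracket_horizontal m1 i m2 gs : (0 < i < n)%N ->
  bracket (m1 ++ [:: (true, i), (true, i) & m2]) gs
  = dloop s * bracket (m1 ++ (true, i) :: m2) gs.
Proof.
move=> hi; elim: gs m2 => [|j gs IH] m2 /=.
  rewrite loops_horizontal //= -exprS prednK // loops_gt0 //.
  by case/andP: hi => _; apply: leq_trans.
by rewrite !rcons_cat /= !IH mulrBr ![dloop s * (_ * _)]mulrCA.
Qed.

Hypothesis hs : s \is a GRing.unit.

(** Expanding the prefix [ws] is linear, so it suffices to treat the two equal letters in front;
    their four smoothings reduce to the identity and a single [e_i]. *)
Lemma bracket_skein m ws i gs : (0 < i < n)%N ->
  bracket m (ws ++ [:: i, i & gs])
  = (s ^+ 3 - s) * bracket m (ws ++ i :: gs) + s ^+ 4 * bracket m (ws ++ gs).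
Proof.
move=> hi; elim: ws m => [|j ws IH] m /=; last by rewrite !IH; ring.
have v m' : bracket (m' ++ [:: (false, i)]) gs = bracket m' gs.
  by rewrite bracket_vertical cats0.
have vh : bracket ((m ++ [:: (false, i)]) ++ [:: (true, i)]) gs
          = bracket (m ++ [:: (true, i)]) gs.
  by rewrite -catA bracket_vertical.
have hh : bracket ((m ++ [:: (true, i)]) ++ [:: (true, i)]) gs
          = dloop s * bracket (m ++ [:: (true, i)]) gs.
  by rewrite -catA bracket_horizontal.
rewrite -!cats1 !v vh hh /dloop; set x := bracket _ _; set y := bracket _ _.
have se : s * s^-1 = 1 by rewrite mulrV.
(* The product [s * s^-1] is isolated so that invertibility of [s] applies; a polynomial identity
   remains. *)
have -> : s ^+ 2 * ((- s^-1 - s) * y) = - (s * s^-1) * s * y - s ^+ 3 * y by ring.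
rewrite se; ring.
Qed.

End Bracket.

(** * Power series whose coefficients obey the recurrence *)

Section Series.
Variables (R : comUnitRingType) (s : R) (k : nat).

Definition upd (a : mono k) (m : 'I_k) (e : nat) : mono k :=
  [ffun j => if j == m then e else a j].

Lemma updC a m m' e e' : m != m' ->
  upd (upd a m e) m' e' = upd (upd a m' e') m e.
Proof.
move=> mm'; apply/ffunP=> j; rewrite !ffunE.
by have [->|//] := eqVneq j m'; rewrite eq_sym (negbTE mm').
Qed.

Definition skein (m : 'I_k) (f : mono k -> R) := forall a e,
  f (upd a m e.+2) = (s ^+ 3 - s) * f (upd a m e.+1) + s ^+ 4 * f (upd a m e).

(** The coefficient at [a] of [Q_0(t_m) f_0 + Q_1(t_m) f_1], where [f_b] is the coefficient of
    [t_m^b] in [f]. *)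
Definition two_term (m : 'I_k) (f : mono k -> R) (a : mono k) : R :=
  \sum_(b : bool) (Qser s b)`_(a m) * f (upd a m b).

Lemma coef_qser i :
  (qser s)`_i = [:: 1; s - s ^+ 3; - s ^+ 4]`_i.
Proof.
have -> : qser s = 1 + (s - s ^+ 3)%:P * 'X - (s ^+ 4)%:P * 'X ^+ 2.
  by rewrite /qser -!mul_polyC !rmorphB /= !rmorphXn /=; ring.
rewrite coefB coefD coef1 !coefCM coefX coefXn.
by case: i => [|[|[|i]]] /=; rewrite ?nth_nil; ring.
Qed.

Lemma mul_var_skein m f : skein m f -> mul_var m (qser s) f =1 two_term m f.
Proof.
move=> fm a; rewrite /mul_var /two_term big_bool /= -/(upd a m _).
under eq_bigr do rewrite coef_qser -/(upd a m _).
rewrite coefX coefB coef1 coefZ coefX.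
case am: (a m) => [|[|e]] /=.
- by rewrite big_ord1 /= subn0; ring.
- by rewrite big_ord_recl big_ord1 /= subn0 subnn; ring.
rewrite 3!big_ord_recl big1 => [|i _]; last by rewrite /= nth_nil mul0r.
rewrite /= /bump /= !add1n subn0 subSS subn0 !subSS subn0 fm; ring.
Qed.

Lemma skein_two_term m m' f : m != m' -> skein m f -> skein m (two_term m' f).
Proof.
move=> mm' fm a e; rewrite /two_term !mulr_sumr -big_split; apply: eq_bigr => b _.
have am' d : upd a m d m' = a m' by rewrite ffunE eq_sym (negbTE mm').
rewrite !am' !(updC _ _ _ mm') fm /=; ring.
Qed.

(** Choices are functions on all of ['I_k]; pinning them to [false] off [l] counts each choice on
    [l] once. *)
Lemma foldr_two_term l f a : uniq l ->
  foldr two_term f l a =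
  \sum_(j in family (fun m : 'I_k => if m \in l then predT else pred1 false))
    (\prod_(m <- l) (Qser s (j m))`_(a m))
      * f [ffun m => if m \in l then nat_of_bool (j m) else a m].
Proof.
elim: l a => [|m l IH] a /=.
  rewrite (big_pred1 [ffun=> false]) => [|j]; last first.
    apply/familyP/eqP=> [jf|-> m]; last by rewrite ffunE.
    by apply/ffunP=> m; rewrite ffunE; apply/eqP/jf.
  rewrite big_nil mul1r => _; congr (f _).
  by apply/ffunP=> m; rewrite ffunE.
case/andP=> ml ul; rewrite {1}/two_term.
(* The sum is split by the value at [m]: [F b] sets it to [b], and [F false] restores the pinned
   value. *)
pose F (b : bool) (j : {ffun 'I_k -> bool}) : {ffun 'I_k -> bool} :=
  [ffun x => if x == m then b else j x].
rewrite [RHS](partition_big (fun j : {ffun 'I_k -> bool} => j m) predT) //=.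
apply: eq_bigr => b _; rewrite IH // mulr_sumr.
rewrite [RHS](reindex_onto (F b) (F false)) /=; last first.
  move=> j /andP[_ /eqP jm]; apply/ffunP=> x; rewrite !ffunE.
  by case: eqP => // ->.
apply: eq_big => [j|j jl].
  apply/familyP/andP=> [jl|[/andP[/familyP jl _] /eqP Fj] x].
    split; last first.
      apply/eqP/ffunP=> x; rewrite !ffunE; case: eqP => // ->.
      by have := jl m; rewrite (negbTE ml) => /eqP.
    apply/andP; split; last by rewrite ffunE eqxx.
    apply/familyP=> x; rewrite ffunE in_cons; case: eqP => //= _; exact: jl.
  have := jl x; rewrite in_cons -Fj !ffunE; case: eqP => //= -> _.
  by rewrite (negbTE ml).
rewrite big_cons mulrA ffunE eqxx; congr (_ * _ * f _).
  apply: eq_big_seq => x xl; rewrite !ffunE; case: eqP => // xm.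
  by rewrite -xm xl in ml.
apply/ffunP=> x; rewrite !ffunE in_cons; case: eqP => //= ->.
by rewrite (negbTE ml).
Qed.

(** Distinctness of [l] ensures that each variable is reached while its own recurrence still
    holds. *)
Lemma foldr_mul_var l f : uniq l -> (forall m, skein m f) ->
  foldr (fun m g => mul_var m (qser s) g) f l =1 foldr two_term f l.
Proof.
move=> + fs; have fold_skein l' m : m \notin l' -> skein m (foldr two_term f l').
  elim: l' => [//|m' l' IH] /=; rewrite in_cons negb_or => /andP[mm' ml'].
  exact/skein_two_term/IH.
elim: l => [//|m l IH] /= /andP[ml ul] a.
rewrite -mul_var_skein; last exact: fold_skein.
by apply: eq_bigr => i _; rewrite IH.
Qed.

Lemma mul_all_skein f a : (forall m, skein m f) ->
  mul_all (qser s) f a = \sum_(j : {ffun 'I_k -> bool})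
    (\prod_(m < k) (Qser s (j m))`_(a m)) * f [ffun m => nat_of_bool (j m)].
Proof.
move=> fs; rewrite /mul_all foldr_mul_var ?foldr_two_term ?enum_uniq //.
apply: eq_big => [j|j _].
  by apply/familyP => m; rewrite mem_enum.
rewrite big_enum; congr (_ * f _).
by apply/ffunP=> m; rewrite !ffunE mem_enum.
Qed.

End Series.

(** * The recurrence for closures of powers of generators *)

Lemma pword_positive k (I : 'I_k -> nat) (a : 'I_k -> nat) :
  pword I a = positive (flatten [seq nseq (a m) (I m) | m <- enum 'I_k]).
Proof.
rewrite /pword /positive map_flatten -map_comp; congr flatten.
by apply: eq_map => m /=; rewrite map_nseq.
Qed.

Lemma jones_skein (R : comUnitRingType) (s : R) n k (I : 'I_k -> nat) (m : 'I_k) :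
  s \is a GRing.unit -> (0 < I m < n)%N ->
  skein s m (fun b => jones s n (pword I b)).
Proof.
move=> hs hm a e; rewrite !pword_positive !jones_positive.
(* Since [m] occurs once in the enumeration, changing its exponent affects a single block of equal
   letters, between [l1] and [l2]. *)
have /splitPr split_m : m \in enum 'I_k by rewrite mem_enum.
have := enum_uniq 'I_k; case: split_m => l1 l2.
rewrite uniq_catC cons_uniq mem_cat negb_or => /andP[/andP[ml2 ml1] _].
have drop_m l d : m \notin l ->
    [seq nseq (upd a m d x) (I x) | x <- l] = [seq nseq (a x) (I x) | x <- l].
  move=> ml; apply/eq_in_map => x xl; rewrite ffunE.
  by case: eqP xl ml => // -> ->.
rewrite !map_cat /= !flatten_cat /= !drop_m // !ffunE eqxx /=.
exact: bracket_skein.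
Qed.

(* (q(t_1)...q(t_k)) * V_{n,I}(t) = sum_{j in {0,1}^k} Q_{j_1}(t_1)...Q_{j_k}(t_k) V_n(x_{i_1}^{j_1}...x_{i_k}^{j_k}),
   compared coefficient by coefficient at every monomial t^a. *)
Theorem theorem1p3 (R : comUnitRingType) (s : R) (hs : s \is a GRing.unit)
  (n k : nat) (hn : (2 <= n)%N) (hk : (1 <= k)%N)
  (I : 'I_k -> nat) (hI : forall m : 'I_k, (0 < I m < n)%N) (a : mono k) :
  mul_all (qser s) (fun b : mono k => jones s n (pword I b)) a
  = \sum_(j : {ffun 'I_k -> bool})
      (\prod_(m < k) (Qser s (j m))`_(a m))
        * jones s n (pword I (fun m => nat_of_bool (j m))).
Proof.
rewrite mul_all_skein => [|m]; last exact: jones_skein.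
apply: eq_bigr => j _; congr (_ * jones _ _ _).
by rewrite /pword; congr flatten; apply: eq_map => m; rewrite ffunE.
Qed.
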